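(* Let $G$ be a finite non-abelian nilpotent group and let $H$ be an abelian subgroup of $G$ with $H \neq Z(H,G)$. Let $|[H,G]| = p$, where $p$ is a prime (not necessarily the smallest prime dividing $|G|$), and let $g \in K(H,G)$. Let $|E(\Gamma_{H,G}^g)|$ denote the number of edges of $\Gamma_{H,G}^g$. Then: (a) If $g = 1$, then $p|E(\Gamma_{H,G}^g)| = (p-1)|G|(|H| - |Z(H,G)|)$. (b) If $g \neq 1$ and $g^2 = 1$, then $2p|E(\Gamma_{H,G}^g)| = 2|G|\left((p-1)|H| + |Z(H,G)|\right) - p|H|(|H|+1)$. (c) If $g \neq 1$ and $g^2 \neq 1$, then $2p|E(\Gamma_{H,G}^g)| = 2|G|\left((p-2)|H| + 2|Z(H,G)|\right) - p|H|(|H|+1)$.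
   Context: For $x,y$ in a group, $[x,y] = x^{-1}y^{-1}xy$. For a subgroup $H$ of $G$: $Z(H,G) = \{x \in H : xy = yx \text{ for all } y \in G\}$, $K(H,G) = \{[x,y] : x \in H,\ y \in G\}$, and $[H,G] = \langle K(H,G)\rangle$. The relative $g$-noncommuting graph $\Gamma_{H,G}^g$ is the simple undirected graph with vertex set $G$ in which two distinct vertices $x,y$ are adjacent if and only if ($x \in H$ or $y \in H$) and $[x,y] \neq g$ and $[x,y] \neq g^{-1}$. *)

(* Defs.v *)
From mathcomp Require Import all_boot all_order all_algebra.
From mathcomp Require Import all_fingroup all_solvable.

Set Implicit Arguments.
Unset Strict Implicit.
Unset Printing Implicit Defensive.

Section RelativeGNoncommutingGraph.

Local Open Scope group_scope.

Variable gT : finGroupType.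

(* [~ x, y] is x^-1 * y^-1 * x * y; since [~ y, x] = [~ x, y]^-1, excluding
   both g and g^-1 makes this relation symmetric. *)
Definition gnc_adj (H : {set gT}) (g : gT) : rel gT :=
  [rel x y | [&& x != y, (x \in H) || (y \in H),
                 [~ x, y] != g & [~ x, y] != g^-1]].

Definition gnc_edges (H G : {set gT}) (g : gT) : {set {set gT}} :=
  [set [set x; y] | x in G, y in G & gnc_adj H g x y].

End RelativeGNoncommutingGraph.

(* Main.v *)
Require Import Defs.
From mathcomp Require Import all_boot all_order all_algebra.
From mathcomp Require Import all_fingroup all_solvable.
From mathcomp Require Import zify ring.

Set Implicit Arguments.
Unset Strict Implicit.
Unset Printing Implicit Defensive.

Import GRing.Theory.
Local Open Scope ring_scope.

(** The subgroup [~: H, G] has prime order and is normal in the nilpotent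
    group G, so it is central.  Hence for each x in H the map y |-> [~ x, y] is
    a homomorphism from G to [~: H, G]; by primality it is trivial when x lies
    in 'C_H(G), and surjective otherwise, in which case every fibre has
    #|G| / p elements (card_comm_fibre).  Summing over x gives the number of
    pairs (x, y) in H x G with [~ x, y] = h, for any h in [~: H, G]
    (card_comm_pairs).

    To pass to edges, every edge corresponds to two ordered pairs of adjacent
    vertices (card_gnc_edges), and inclusion-exclusion on which of the two
    vertices lies in H gives 2 E + B = 2 A, where A and B count the adjacent
    pairs in H x G and in H x H (card_gnc_edges_split).  Since H is abelian,
    commutators inside H are trivial: B is 0 if g = 1, and otherwise any two
    distinct elements of H are adjacent.  Finally A is obtained from
    #|H| * #|G| by removing the diagonal and the pairs whose commutator is g or
    g^-1; these exclusions overlap exactly when g = 1 (the diagonal) or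
    g ^+ 2 = 1 (g and g^-1), whence the three cases. *)

(** * Commutator fibres *)

Section CommutatorCount.

Local Open Scope group_scope.

Variables (gT : finGroupType) (G H : {group gT}).

Lemma prime_commg_central (nilG : nilpotent G) (sHG : H \subset G) :
  prime #|[~: H, G]| -> [~: H, G] \subset 'Z(G).
Proof.
move=> prHG.
have nHG : [~: H, G] <| G.
  rewrite /normal commg_normr andbT.
  by apply: subset_trans (commSg G sHG) (der_sub 1 G).
have ntHG : [~: H, G] :!=: 1 by rewrite -cardG_gt1 prime_gt1.
(* A nontrivial normal subgroup of a nilpotent group meets the centre. *)
exact/(prime_meetG prHG)/(meet_center_nil nilG).
Qed.

Hypothesis cHG : [~: H, G] \subset 'Z(G).

(** The identity [~ x, y * z] = [~ x, z] * [~ x, y] ^ z loses its conjugation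
    and its order reversal when commutators are central. *)
Lemma commgM_central x : x \in H ->
  {in G &, {morph commg x : y z / y * z}}.
Proof.
move=> Hx y z Gy Gz.
have /setIP[Gc /centP cc] : [~ x, y] \in 'Z(G).
  by apply: subsetP cHG _ _; apply: mem_commg.
rewrite commgMJ (conjgE _ z) (cc z Gz) mulKg.
have /setIP[_ /centP cz] : [~ x, z] \in 'Z(G).
  by apply: subsetP cHG _ _; apply: mem_commg.
by rewrite cz.
Qed.

(** The image of y |-> [~ x, y] is a nontrivial subgroup of a group of prime
    order, hence all of it, and the fibres are the cosets of the kernel. *)
Lemma card_comm_fibre x h :
    prime #|[~: H, G]| -> x \in H -> x \notin 'C(G) -> h \in [~: H, G] ->
  (#|[~: H, G]| * #|[set y in G | [~ x, y] == h]|)%N = #|G|.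
Proof.
move=> prHG Hx nCx HGh.
pose f := Morphism (commgM_central Hx).
have sfHG : f @* G \subset [~: H, G].
  by apply/subsetP=> _ /morphimP[y _ Gy ->]; apply: mem_commg.
have fG : f @* G = [~: H, G].
  apply/eqP; rewrite eqEsubset sfHG /=.
  apply: prime_meetG => //; rewrite (setIidPr sfHG).
  apply: contra nCx => /eqP f1; apply/centP=> y Gy.
  by apply/commgP; rewrite -in_set1 -[[set 1]]f1 (mem_morphim f).
have /morphimP[y0 _ Gy0 Dh] : h \in f @* G by rewrite fG.
have -> : [set y in G | [~ x, y] == h] = 'ker f :* y0.
  apply/setP=> y; rewrite inE Dh.
  apply/andP/idP=> [[Gy /eqP fy] | ky].
    exact/(rcoset_kerP f).
  have Gy : y \in G.
    by case/rcosetP: ky => k /dom_ker Gk ->; rewrite groupM.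
  by split=> //; apply/eqP; apply/(rcoset_kerP f).
rewrite card_rcoset -{1}fG card_morphim setIid mulnC.
by rewrite Lagrange // subsetIl.
Qed.

End CommutatorCount.

(** * Counting pairs *)

Section PairCount.

Local Open Scope group_scope.

Lemma card_setId_sum (T : finType) (A : {set T}) (P : pred T) :
  #|[set u in A | P u]| = (\sum_(u in A) P u)%N.
Proof.
rewrite -sum1_card big_mkcond [RHS]big_mkcond /=.
by apply: eq_bigr => u _; rewrite inE; case: (u \in A); case: (P u).
Qed.

Definition comm_pairs (gT : finGroupType) (A B : {set gT}) (h : gT) :=
  [set u in setX A B | [~ u.1, u.2] == h].

(** Each noncentral x contributes #|G| / p pairs for any h, each central x
    contributes #|G| pairs for h = 1 only; both sides are multiplied and
    rearranged so as to avoid division and subtraction. *)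
Lemma card_comm_pairs (gT : finGroupType) (G H : {group gT}) (h : gT) :
    nilpotent G -> H \subset G -> prime #|[~: H, G]| -> h \in [~: H, G] ->
  (#|[~: H, G]| * #|comm_pairs H G h| + #|'C_H(G)| * #|G|)%N =
  (#|H| * #|G| + (h == 1%g) * (#|[~: H, G]| * (#|'C_H(G)| * #|G|)))%N.
Proof.
move=> nilG sHG prHG HGh.
have cHG := prime_commg_central nilG sHG prHG.
set p := #|[~: H, G]|.
have -> : #|comm_pairs H G h| =
    (\sum_(x in H) #|[set y in G | [~ x, y] == h]|)%N.
  rewrite card_setId_sum.
  under [RHS]eq_bigr do rewrite card_setId_sum.
  by rewrite pair_big; apply: eq_bigl => -[x y]; rewrite inE.
rewrite (big_setID 'C(G)) /=.
have -> : (\sum_(x in H :&: 'C(G)) #|[set y in G | [~ x, y] == h]| =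
    #|'C_H(G)| * ((h == 1%g) * #|G|))%N.
  rewrite -sum_nat_const; apply: eq_bigr => x /setIP[_ /centP cx].
  rewrite card_setId_sum mulnC -sum_nat_const; apply: eq_bigr => y Gy.
  by have /commgP/eqP-> := cx y Gy; rewrite eq_sym.
rewrite mulnDr [X in (_ + X + _)%N]big_distrr /=.
rewrite [X in (_ + X + _)%N](eq_bigr (fun=> #|G|)); last first.
  by move=> x /setDP[Hx nCx]; apply: card_comm_fibre.
rewrite sum_nat_const -(cardsID 'C(G) H).
ring.
Qed.

End PairCount.

(** * Edges as ordered pairs *)

Section Edges.

Local Open Scope group_scope.

Variables (gT : finGroupType) (g : gT).

Definition gnc_pairs (H A B : {set gT}) : {set gT * gT} :=
  [set u in setX A B | gnc_adj H g u.1 u.2].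

Lemma gnc_adj_sym (H : {set gT}) : symmetric (gnc_adj H g).
Proof.
move=> x y; rewrite /gnc_adj /= eq_sym orbC -(invg_comm x y).
rewrite (inv_eq invgK) (inj_eq invg_inj).
by rewrite [X in _ && (_ && X)]andbC.
Qed.

(** Handshake: the fibre of (x, y) |-> [set x; y] over an edge consists of the
    two orientations of this edge. *)
Lemma card_gnc_edges (H G : {set gT}) :
  (2 * #|gnc_edges H G g|)%N = #|gnc_pairs H G G|.
Proof.
pose f (u : gT * gT) : {set gT} := [set u.1; u.2].
have -> : gnc_edges H G g = f @: gnc_pairs H G G.
  apply/setP=> e; apply/imset2P/imsetP => [[x y Gx] | [[x y]]].
    by rewrite inE => /andP[Gy xy] ->; exists (x, y); rewrite ?inE /= ?Gx ?Gy.
  rewrite !inE /= -andbA => /and3P[Gx Gy xy] ->; exists x y => //.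
  by rewrite inE Gy.
rewrite -[RHS]sum1_card (partition_big_imset f) /= mulnC -sum_nat_const.
apply: eq_bigr => _ /imsetP[[x y] uP ->].
move: (uP); rewrite !inE /= -andbA => /and3P[Gx Gy xy].
have nxy : x != y by case/andP: xy.
rewrite sum1dep_card -[LHS](_ : #|[set (x, y); (y, x)]| = 2); last first.
  by rewrite cards2 xpair_eqE negb_and nxy.
apply: eq_card => -[a b]; rewrite !inE /= !xpair_eqE.
apply/idP/andP=> [/orP[] /andP[/eqP-> /eqP->] | [/andP[_ ab] /eqP E]].
- by rewrite Gx Gy.
- by rewrite Gx Gy gnc_adj_sym /f /= setUC.
have nab : a != b by case/andP: ab.
have := set21 a b; have := set22 a b; rewrite -/(f (a, b)) E !inE /=.
by case/orP=> /eqP Db /orP[] /eqP Da; move: nab; rewrite Da Db ?eqxx // orbT.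
Qed.

(** Some endpoint lies in H, so adjacent pairs are those starting in H
    together with those ending in H, and both families have the same size. *)
Lemma card_gnc_edges_split (H G : {set gT}) : H \subset G ->
  (2 * #|gnc_edges H G g| + #|gnc_pairs H H H| = 2 * #|gnc_pairs H H G|)%N.
Proof.
move=> sHG; rewrite card_gnc_edges.
have -> : gnc_pairs H G G = gnc_pairs H H G :|: gnc_pairs H G H.
  apply/setP=> -[x y]; rewrite !inE /= /gnc_adj /=.
  have := subsetP sHG x; have := subsetP sHG y.
  case: (x \in H); case: (y \in H) => /= Gy Gx; rewrite ?andbF ?orbF //.
  - by rewrite Gx // Gy // orbb.
  - by rewrite Gx.
  - by rewrite Gy.
have -> : gnc_pairs H H H = gnc_pairs H H G :&: gnc_pairs H G H.
  apply/setP=> -[x y]; rewrite !inE /=.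
  have := subsetP sHG x; have := subsetP sHG y.
  case: (x \in H); case: (y \in H) => /= Gy Gx; rewrite ?andbF ?andFb //.
  by rewrite Gx // Gy //= andbb.
rewrite cardsUI mul2n -addnn; congr addn.
rewrite -[LHS](card_imset _ (can_inj (@swap_pairK gT gT))).
apply: eq_card => -[x y]; rewrite -[(x, y)]/(swap_pair (y, x)).
rewrite (mem_imset _ _ (can_inj (@swap_pairK gT gT))) !inE /=.
by rewrite gnc_adj_sym [(y \in G) && _]andbC.
Qed.

Lemma card_diag (A B : {set gT}) : A \subset B ->
  #|[set u in setX A B | u.1 == u.2]| = #|A|.
Proof.
move=> sAB; have injd : injective (fun x : gT => (x, x)) by move=> x y [].
rewrite -(card_imset _ injd); apply: eq_card => -[x y]; rewrite !inE /=.
apply/idP/imsetP=> [/andP[/andP[Ax _] /eqP<-] | [z Az [-> ->]]].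
  by exists x.
by rewrite Az (subsetP sAB) ?eqxx.
Qed.

Lemma card_gnc_pairs1 (H A B : {set gT}) : A \subset H -> g = 1 ->
  (#|gnc_pairs H A B| + #|comm_pairs A B 1|)%N = (#|A| * #|B|)%N.
Proof.
move=> sAH g1; rewrite -cardsX !card_setId_sum -sum1_card -big_split /=.
apply: eq_bigr => -[x y] /setXP[/= Ax _].
rewrite /gnc_adj /= (subsetP sAH x Ax) g1 invg1 andbb /=.
case: eqP => [<- | _]; first by rewrite commgg eqxx.
by case: eqP.
Qed.

(** A pair fails to be adjacent for exactly one of three reasons: it is
    diagonal, or its commutator is g, or it is g^-1.  The diagonal is separate
    because g != 1; the factor (g^-1 != g) avoids counting an involution g
    twice. *)
Lemma card_gnc_pairs_neq1 (H A B : {set gT}) :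
    A \subset H -> A \subset B -> g != 1 ->
  (#|gnc_pairs H A B| + #|A| + #|comm_pairs A B g|
     + (g^-1 != g) * #|comm_pairs A B g^-1|)%N = (#|A| * #|B|)%N.
Proof.
move=> sAH sAB ntg; rewrite -{1}(card_diag sAB) -[RHS]cardsX.
rewrite !card_setId_sum -sum1_card big_distrr -!big_split /=.
apply: eq_bigr => -[x y] /setXP[/= Ax _].
rewrite /gnc_adj /= (subsetP sAH x Ax) /=.
have [<- | _] := eqVneq x y.
  by rewrite commgg !(eq_sym 1) invg_eq1 (negPf ntg) muln0.
have [-> | ncg] := eqVneq [~ x, y] g.
  by rewrite eq_sym; case: eqP.
have [Dc | _] := eqVneq [~ x, y] g^-1; last by rewrite muln0.
by rewrite -Dc ncg.
Qed.

Lemma card_comm_pairs_abelian (H : {group gT}) (h : gT) : abelian H ->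
  #|comm_pairs H H h| = ((h == 1%g) * (#|H| * #|H|))%N.
Proof.
move=> /centsP abH; rewrite card_setId_sum -cardsX mulnC -sum_nat_const.
apply: eq_bigr => -[x y] /setXP[/= Hx Hy].
by have /commgP/eqP-> := abH x Hx y Hy; rewrite eq_sym.
Qed.

End Edges.

(** * Edge counts *)

Theorem corollary3p4 (gT : finGroupType) (G H : {group gT}) (p : nat) (g : gT)
    (Gnonab : ~~ abelian G) (Gnil : nilpotent G)
    (sHG : H \subset G) (abH : abelian H)
    (HneqZ : H :!=: 'C_H(G)%g)
    (p_pr : prime p) (oHG : #|[~: H, G]%g| = p)
    (gK : g \in commg_set H G) :
  [/\ g = 1%g ->
        p%:Z * #|gnc_edges H G g|%:Z =
          (p%:Z - 1) * #|G|%:Z * (#|H|%:Z - #|'C_H(G)%g|%:Z),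
      g <> 1%g -> (g ^+ 2)%g = 1%g ->
        2 * p%:Z * #|gnc_edges H G g|%:Z =
          2 * #|G|%:Z * ((p%:Z - 1) * #|H|%:Z + #|'C_H(G)%g|%:Z)
          - p%:Z * #|H|%:Z * (#|H|%:Z + 1)
    & g <> 1%g -> (g ^+ 2)%g <> 1%g ->
        2 * p%:Z * #|gnc_edges H G g|%:Z =
          2 * #|G|%:Z * ((p%:Z - 2) * #|H|%:Z + 2 * #|'C_H(G)%g|%:Z)
          - p%:Z * #|H|%:Z * (#|H|%:Z + 1)].
Proof.
have prHG : prime #|[~: H, G]%g| by rewrite oHG.
have HGg : g \in [~: H, G]%g by apply: mem_gen.
have HGgV : (g^-1)%g \in [~: H, G]%g by rewrite groupV.
have cg h := card_comm_pairs Gnil sHG prHG (h := h).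
have cH h := card_comm_pairs_abelian h abH.
rewrite oHG in cg.
have edgesp := congr1 (muln p) (card_gnc_edges_split g sHG).
(* Multiplied by p, the relations between edges and pairs make each case linear
   in the counts. *)
split=> [g1 | /eqP ntg g2 | /eqP ntg g2].
- have := congr1 (muln p) (card_gnc_pairs1 G (subxx H) g1).
  have := congr1 (muln p) (card_gnc_pairs1 H (subxx H) g1).
  move: (cg 1%g (group1 _)) edgesp; rewrite cH eqxx.
  set h := #|H|; set n := #|G|; set z := #|'C_H(G)%g|; clear; lia.
- have gV : (g^-1 = g)%g by apply/eqP; rewrite eq_invg_mul -[(g * g)%g]/(g ^+ 2)%g g2.
  have := congr1 (muln p) (card_gnc_pairs_neq1 (subxx H) sHG ntg).
  have := congr1 (muln p) (card_gnc_pairs_neq1 (subxx H) (subxx H) ntg).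
  move: (cg g HGg) edgesp; rewrite gV !cH eqxx (negPf ntg).
  set h := #|H|; set n := #|G|; set z := #|'C_H(G)%g|; clear; lia.
have gV : (g^-1 != g)%g.
  by apply/eqP=> gV; case: g2; rewrite expgS expg1 -{1}gV mulVg.
have := congr1 (muln p) (card_gnc_pairs_neq1 (subxx H) sHG ntg).
have := congr1 (muln p) (card_gnc_pairs_neq1 (subxx H) (subxx H) ntg).
move: (cg g HGg) (cg _ HGgV) edgesp; rewrite !cH invg_eq1 gV (negPf ntg).
set h := #|H|; set n := #|G|; set z := #|'C_H(G)%g|; clear; lia.
Qed.
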